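(* Let $G$ be a graph with maximum degree $\Delta$ and minimum degree $\delta\geq 1$. Then $$\chi_2(G)-\chi(G)\leq \left\lceil e\,\frac{\Delta}{\delta}\log\big(2e(\Delta^2+1)\big)\right\rceil .$$
   Context: Graphs are finite and simple. $\chi(G)$ is the chromatic number of $G$. A dynamic ($2$-dynamic) $k$-coloring of $G$ is a proper vertex coloring of $G$ with $k$ colors such that, for every vertex $v$, at least $\min\{2,\deg(v)\}$ different colors appear on the neighbors of $v$; $\chi_2(G)$ is the smallest $k$ such that $G$ has a dynamic $k$-coloring. $\log$ is the natural logarithm and $e$ is its base. *)

(* Defs.v *)
From mathcomp Require Import all_boot.

Set Implicit Arguments.
Unset Strict Implicit.
Unset Printing Implicit Defensive.

Record sgraph := SGraph {
  vertex :> finType;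
  adj : rel vertex;
  adj_sym : symmetric adj;
  adj_irrefl : irreflexive adj
}.

Section Graph.
Variable G : sgraph.

Definition neigh (v : G) : {set G} := [set u | adj v u].

Definition deg (v : G) : nat := #|neigh v|.

Definition max_degree : nat := \max_(v : G) deg v.

(* Every degree is smaller than #|G|, so the default value #|G| only matters
   for the graph without vertices, whose minimum degree is set to 0. *)
Definition min_degree : nat := \big[minn/#|G|]_(v : G) deg v.

Definition proper_coloring (k : nat) (c : {ffun G -> 'I_k}) : bool :=
  [forall u, forall v, adj u v ==> (c u != c v)].

Definition dynamic_coloring (k : nat) (c : {ffun G -> 'I_k}) : bool :=
  proper_coloring c && [forall v, minn 2 (deg v) <= #|c @: neigh v|].

Definition colorable (k : nat) : bool :=
  [exists c : {ffun G -> 'I_k}, proper_coloring c].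

Definition dynamic_colorable (k : nat) : bool :=
  [exists c : {ffun G -> 'I_k}, dynamic_coloring c].

Lemma dynamic_colorable_card : dynamic_colorable #|G|.
Proof.
apply/existsP; exists [ffun v => enum_rank v]; apply/andP; split.
  apply/forallP=> u; apply/forallP=> v; apply/implyP=> uv.
  rewrite !ffunE (inj_eq enum_rank_inj); apply/eqP=> eq_uv.
  by rewrite eq_uv adj_irrefl in uv.
apply/forallP=> v; rewrite card_imset ?geq_minr // => x y.
by rewrite !ffunE => /enum_rank_inj.
Qed.

Lemma colorable_ex : exists k, colorable k.
Proof.
exists #|G|; have /existsP[c /andP[c_proper _]] := dynamic_colorable_card.
by apply/existsP; exists c.
Qed.

Lemma dynamic_colorable_ex : exists k, dynamic_colorable k.
Proof. by exists #|G|; apply: dynamic_colorable_card. Qed.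

Definition chromatic_number : nat := ex_minn colorable_ex.

Definition dynamic_chromatic_number : nat := ex_minn dynamic_colorable_ex.

End Graph.

(* Main.v *)
(** Recolour a set [T] of vertices with [k] new colours.  If [T] meets every
    neighbourhood, contains none, and meets each in fewer than [k] vertices,
    then [T] can be recoloured greedily and every vertex sees both an old and a
    new colour.  Write [L = log (2e(Delta^2 + 1))].

    If [delta >= e L], let [T] contain each vertex with probability
    [p = L / delta].  A given neighbourhood is missed with probability at most
    [exp (- L)], has at least [e p Delta] vertices in [T] with probability at
    most [exp (- L)] (Chernoff), and is contained in [T] with probability at
    most [p ^ delta <= exp (- 2 L)].  A bad event depends on at most
    [Delta^2 - 1] others, and replacing [Delta^2 + 1] by [Delta^2] in the Lovasz
    local lemma leaves enough room for the third kind of bad event.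

    If [delta < e L], then [k > Delta], and a minimal set [T] meeting every
    neighbourhood works, even though it may contain some neighbourhoods. *)

Require Import Defs.
From mathcomp Require Import all_boot all_order all_algebra.
From mathcomp Require Import reals sequences exp.
From mathcomp Require Import zify ring lra.

Import Order.TTheory GRing.Theory Num.Theory.
Local Open Scope ring_scope.

Set Implicit Arguments.
Unset Strict Implicit.
Unset Printing Implicit Defensive.

(** * Random subsets and the local lemma *)

Section RandomSubset.
Variables (R : realFieldType) (V : finType) (p : R).
Hypotheses (p_ge0 : 0 <= p) (p_le1 : p <= 1).

(** Probability that the random set is [S] when each vertex is taken independently with probability
    [p]. *)
Definition weight (S : {set V}) : R := \prod_x (if x \in S then p else 1 - p).

Definition prob (E : pred {set V}) : R := \sum_(S | E S) weight S.

Definition depends_on (A : {set V}) (E : pred {set V}) :=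
  forall S T, S :&: A = T :&: A -> E S = E T.

Lemma weight_ge0 S : 0 <= weight S.
Proof. by apply: prodr_ge0 => x _; case: ifP => _; rewrite ?subr_ge0. Qed.

Lemma prob_ge0 E : 0 <= prob E.
Proof. by apply: sumr_ge0 => S _; apply: weight_ge0. Qed.

Lemma le_prob (E F : pred {set V}) : subpred E F -> prob E <= prob F.
Proof.
move=> EF; rewrite /prob big_mkcond [leRHS]big_mkcond /=.
apply: ler_sum => S _; case: ifP => [/EF -> //|_].
by case: ifP => // _; apply: weight_ge0.
Qed.

Lemma probID (E F : pred {set V}) :
  prob E = prob (predI F E) + prob (predI E (predC F)).
Proof.
by rewrite /prob (bigID F); congr (_ + _); apply: eq_bigl => S; apply: andbC.
Qed.

Lemma prob_or (E F : pred {set V}) : prob (predU E F) <= prob E + prob F.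
Proof.
rewrite (probID _ E); apply: lerD; apply: le_prob => S /=.
  by case/andP.
by case/andP=> /orP[->|].
Qed.

(** Distributivity: when the product over all [x] is expanded, the term of [S] takes the [p] summand
    on [S] and the [1 - p] summand elsewhere. *)
Lemma sum_weight_prod (g : bool -> R) (A : {set V}) :
  \sum_S weight S * \prod_(x in A) g (x \in S) =
  (p * g true + (1 - p) * g false) ^+ #|A|.
Proof.
rewrite -prodr_const [RHS]big_mkcond /=.
pose F x := p * (if x \in A then g true else 1).
pose H x := (1 - p) * (if x \in A then g false else 1).
transitivity (\prod_x (F x + H x)); last first.
  by apply: eq_bigr => x _; rewrite /F /H; case: ifP => // _; rewrite !mulr1 subrKC.
rewrite bigA_distr; apply: eq_big => [S|S _]; first by rewrite inE.
rewrite /weight [X in _ * X]big_mkcond -big_split /=.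
by apply: eq_bigr => x _; rewrite /F /H; case: (x \in S).
Qed.

Lemma sum_weight : \sum_S weight S = 1.
Proof.
rewrite -[RHS](expr0 (p * 1 + (1 - p) * 1)) -(cards0 V).
by rewrite -(sum_weight_prod (fun=> 1)); apply: eq_bigr => S _; rewrite big_set0 mulr1.
Qed.

Lemma prob_subset (A : {set V}) : prob (fun S => A \subset S) = p ^+ #|A|.
Proof.
rewrite -[p in RHS]mulr1 -[_ * 1]addr0 -(mulr0 (1 - p)).
rewrite -(sum_weight_prod (fun b : bool => b%:R)) /prob big_mkcond.
apply: eq_bigr => S _; case: ifPn => [/subsetP AS|/subsetPn[x xA xS]].
  by rewrite big1 ?mulr1 // => x /AS ->.
by rewrite (bigD1 x) //= (negPf xS) mul0r mulr0.
Qed.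

Lemma prob_disjoint (A : {set V}) :
  prob (fun S => [disjoint A & S]) = (1 - p) ^+ #|A|.
Proof.
rewrite -[1 - p in RHS]mulr1 -[_ * 1]add0r -(mulr0 p).
rewrite -(sum_weight_prod (fun b : bool => (~~ b)%:R)) /prob big_mkcond.
apply: eq_bigr => S _; case: ifPn => [|/pred0Pn[x /andP[/= xA xS]]].
  by move=> /disjointFr AS; rewrite big1 ?mulr1 // => x /AS ->.
by rewrite (bigD1 x) //= xS mul0r mulr0.
Qed.

(** Markov's inequality for [y ^+ #|A :&: S|]; [z] stands for the power of [y] with the real
    exponent [a]. *)
Lemma prob_card_ge (a y z : R) (A : {set V}) : 0 <= y ->
  (forall k, a <= k%:R -> z <= y ^+ k) ->
  z * prob (fun S => a <= #|A :&: S|%:R) <= (p * y + (1 - p)) ^+ #|A|.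
Proof.
move=> y0 zy; rewrite -[1 - p]mulr1 -(sum_weight_prod (fun b => if b then y else 1)).
rewrite mulr_sumr big_mkcond; apply: ler_sum => S _ /=.
have -> : \prod_(x in A) (if x \in S then y else 1) = y ^+ #|A :&: S|.
  rewrite -big_mkcondr -prodr_const; apply: eq_bigl => x; by rewrite inE.
rewrite mulrC; case: ifP => [/zy|_]; last by rewrite mulr_ge0 ?exprn_ge0 ?weight_ge0.
by apply: ler_wpM2l; apply: weight_ge0.
Qed.

(* Exchanging the parts inside [A] of two independent samples is a
   weight-preserving involution of the pairs of samples. *)
Lemma prob_indep (A : {set V}) (E F : pred {set V}) :
  depends_on A E -> depends_on (~: A) F ->
  prob (predI E F) = prob E * prob F.
Proof.
move=> dE dF.
pose mix (ST : {set V} * {set V}) :=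
  ((ST.1 :&: A) :|: (ST.2 :\: A), (ST.2 :&: A) :|: (ST.1 :\: A)).
have mixK : involutive mix.
  by move=> [S T]; congr pair; apply/setP=> x; rewrite !inE /=;
    case: (x \in A); case: (x \in S); case: (x \in T).
transitivity (prob (predI E F) * \sum_T weight T).
  by rewrite sum_weight mulr1.
rewrite /prob !big_distrlr /= !pair_big /= (reindex_inj (inv_inj mixK)) /=.
apply: eq_big => [[S T]|[S T] _] /=.
  rewrite andbT; congr andb.
    by apply: dE; apply/setP => x; rewrite !inE /=; case: (x \in A);
      rewrite ?andbF ?orbF ?andbT.
  by apply: dF; apply/setP => x; rewrite !inE /=; case: (x \in A);
    rewrite ?andbF ?orbF ?andbT.
rewrite /weight -!big_split /=; apply: eq_bigr => x _.
rewrite !inE; case: (x \in A); rewrite ?andbF ?orbF ?andbT //=.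
by rewrite mulrC.
Qed.

(** * The symmetric Lovasz local lemma *)

Section LocalLemma.
Variables (I : finType) (E : I -> pred {set V}) (A : I -> {set V}).
Variables (x : R) (d : nat).
Hypothesis E_dep : forall i, depends_on (A i) (E i).
Hypotheses (x_ge0 : 0 <= x) (x_lt1 : x < 1).
Hypothesis probE : forall i, prob (E i) <= x * (1 - x) ^+ d.
Hypothesis deg_dep :
  forall i, (#|[set j | (j != i) && ~~ [disjoint A i & A j]]| <= d)%N.

Definition avoid (J : {set I}) : pred {set V} :=
  fun S => [forall j in J, ~~ E j S].

Lemma avoid_set0 S : avoid set0 S.
Proof. by apply/forall_inP => j; rewrite inE. Qed.

Lemma avoidU1 i J : avoid (i |: J) =1 predI (avoid J) (predC (E i)).
Proof.
move=> S; apply/forall_inP/andP => [iJ|[/forall_inP J_ iS j]].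
  split; last by apply: iJ; rewrite setU11.
  by apply/forall_inP => j jJ; apply: iJ; rewrite setU1r.
by case/setU1P => [->|/J_].
Qed.

Lemma eq_prob (F G : pred {set V}) : F =1 G -> prob F = prob G.
Proof. exact: eq_bigl. Qed.

Lemma avoid_dep (J : {set I}) (B : {set V}) :
  (forall j, j \in J -> A j \subset B) -> depends_on B (avoid J).
Proof.
move=> JB S T ST; apply: eq_forallb_in => j jJ; congr (~~ _).
by apply: E_dep; rewrite -(setIidPr (JB j jJ)) !setIA ST.
Qed.

(** Chain rule: avoiding the events of [K] one after another costs at worst a factor [1 - x] each,
    by the conditional bound in the premise. *)
Lemma prob_avoid_ge (J K L : {set I}) :
    (forall (M : {set I}) j, M \subset J -> j \in J -> j \notin M ->
      prob (predI (E j) (avoid M)) <= x * prob (avoid M)) ->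
    K \subset J -> L \subset J -> [disjoint K & L] ->
  (1 - x) ^+ #|K| * prob (avoid L) <= prob (avoid (K :|: L)).
Proof.
move=> condJ; have [m] := ubnP #|K|; elim: m K => // m IH K leK KJ LJ KL.
have [->|[j jK]] := set_0Vmem K; first by rewrite cards0 mul1r set0U.
move: leK; rewrite (cardsD1 j) jK ltnS => leK; rewrite exprS.
have KjJ : K :\ j \subset J := subset_trans (subsetDl _ _) KJ.
have := IH _ leK KjJ LJ (disjointWl (subsetDl _ _) KL).
set M := _ :|: L => IHK.
have jM : j \notin M by rewrite !inE eqxx /= (disjointFr KL).
have MJ : M \subset J by rewrite subUset KjJ.
have := condJ M j MJ (subsetP KJ j jK) jM.
have -> : K :|: L = j |: M by rewrite setUA setD1K.
rewrite (eq_prob (avoidU1 j M)) => condM.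
apply: le_trans (_ : (1 - x) * prob (avoid M) <= _).
  by rewrite -mulrA ler_wpM2l // subr_ge0 ltW.
by move: condM; rewrite (probID (avoid M) (E j)); lra.
Qed.

(* The usual conditional bound [P(E i | avoid J) <= x], without division. *)
Lemma prob_cond_avoid (J : {set I}) i : i \notin J ->
  prob (predI (E i) (avoid J)) <= x * prob (avoid J).
Proof.
have [m] := ubnP #|J|; elim: m J i => // m IH J i leJ iJ.
pose far := J :&: [set j | [disjoint A i & A j]].
have farJ : far \subset J by apply: subsetIl.
have near_far : (J :\: far) :|: far = J by rewrite setUC -[RHS](setID J far) (setIidPr farJ).
have card_near : (#|J :\: far| <= d)%N.
  apply: leq_trans (deg_dep i); apply: subset_leq_card; apply/subsetP => j.
  rewrite !inE negb_and => /andP[/orP[/negP//|-> jJ]]; rewrite andbT.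
  by apply: contraNneq iJ => <-.
(* The induction applies to [M] because it misses [j] and so is smaller than [J]. *)
have near_ge : (1 - x) ^+ d * prob (avoid far) <= prob (avoid J).
  rewrite -[in leRHS]near_far.
  apply: le_trans (prob_avoid_ge (J := J) _ _ _ _).
  - rewrite ler_wpM2r ?prob_ge0 // ler_wiXn2l // ?subr_ge0 ?(ltW x_lt1) //.
    by rewrite gerBl.
  - move=> M j MJ jJ jM; apply: IH => //.
    apply: leq_trans (_ : #|J| <= m)%N => //; apply: proper_card.
    by apply/properP; split=> //; exists j.
  - exact: subsetDl.
  - exact: farJ.
  - by rewrite disjoint_sym disjoints_subset; apply/subsetP => j; rewrite !inE => ->.
(* Forgetting the near events enlarges the event, and [avoid far] is independent of [E i]. *)
apply: le_trans (_ : prob (E i) * prob (avoid far) <= _).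
  rewrite -(prob_indep (A := A i)) //; last first.
    by apply: avoid_dep => j; rewrite !inE disjoint_sym disjoints_subset => /andP[].
  apply: le_prob => S /andP[/= -> /forall_inP aJ] /=.
  by apply/forall_inP => j /(subsetP farJ) /aJ.
apply: le_trans (_ : x * ((1 - x) ^+ d * prob (avoid far)) <= _).
  by rewrite mulrA; apply: ler_wpM2r (probE i); apply: prob_ge0.
exact: ler_wpM2l.
Qed.

(** The chain rule over all events bounds the probability of avoiding them below by a power of
    [1 - x], which is positive. *)
Theorem local_lemma : exists S, forall i, ~~ E i S.
Proof.
have [S /forall_inP aS|no] := pickP (avoid setT).
  by exists S => i; apply: aS.
have cond (M : {set I}) j : M \subset [set: I] -> j \in [set: I] ->
  j \notin M -> prob (predI (E j) (avoid M)) <= x * prob (avoid M).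
  by move=> _ _; apply: prob_cond_avoid.
have := prob_avoid_ge cond (subsetT setT) (subsetT set0).
rewrite -setI_eq0 setI0 eqxx setU0 (eq_prob no) [prob pred0]big_pred0 //.
have -> : prob (avoid set0) = 1.
  by rewrite -sum_weight; apply: eq_bigl => S; rewrite avoid_set0.
by rewrite mulr1 leNgt exprn_gt0 ?subr_gt0 // => /(_ isT).
Qed.

End LocalLemma.
End RandomSubset.

(** * Recolouring a hitting set *)

(** Greedy: set aside a [t] of small degree, colour the rest, and give [t] one of the [n.+1] colours
    not among its at most [n] forbidden ones. *)
Lemma degenerate_coloring (V : finType) (e : rel V) (n : nat) (T : {set V}) :
    symmetric e -> irreflexive e ->
    (forall S : {set V}, S \subset T -> S != set0 ->
      exists2 t, t \in S & (#|[set s in S | e t s]| <= n)%N) ->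
  exists d : V -> 'I_n.+1, {in T &, forall s t, e s t -> d s != d t}.
Proof.
move=> e_sym e_irr degT.
have [m] := ubnP #|T|; elim: m T degT => // m IH T degT leT.
have [->|T0] := eqVneq T set0.
  by exists (fun=> ord0) => s t; rewrite inE.
have [t tT degt] := degT T (subxx T) T0.
have [|| d dP] := IH (T :\ t).
- by move=> S /subset_trans ST; apply: degT; apply: ST; apply: subsetDl.
- by move: leT; rewrite (cardsD1 t) tT.
have [a aP] : exists a, a \notin d @: [set s in T | e t s].
  apply/existsP; rewrite -negb_forall; apply/negP => /forallP all_in.
  have : (#|'I_n.+1| <= #|d @: [set s in T | e t s]|)%N.
    by apply: subset_leq_card; apply/subsetP => a _; apply: all_in.
  by rewrite card_ord leqNgt ltnS (leq_trans (leq_imset_card _ _)).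
have aPs s : s \in T -> e t s -> a != d s.
  by move=> sT ets; apply: contraNneq aP => ->; apply: imset_f; rewrite inE sT.
exists (fun s => if s == t then a else d s) => r s rT sT ers.
case: (eqVneq r t) => [rt|rt]; case: (eqVneq s t) => [st|st].
- by rewrite rt st e_irr in ers.
- by apply: aPs => //; rewrite -rt.
- by rewrite eq_sym; apply: aPs => //; rewrite -st e_sym.
- by apply: dP => //; rewrite !inE ?rt ?st.
Qed.

Section Graph.
Variable G : sgraph.
Implicit Types (u v : G) (T : {set G}).

Lemma mem_neigh u v : (u \in neigh v) = adj v u.
Proof. by rewrite inE. Qed.

Lemma deg_le_max v : (deg v <= max_degree G)%N.
Proof. exact: leq_bigmax. Qed.

Lemma min_le_deg v : (min_degree G <= deg v)%N.
Proof.
rewrite /min_degree; have := mem_index_enum v.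
elim: (index_enum G) => // u s IH; rewrite inE big_cons geq_min.
by case/orP => [/eqP->|/IH->]; rewrite ?leqnn ?orbT.
Qed.

(** New colours never clash with old ones, so a neighbourhood meeting both [T] and its complement
    sees two colours; the last premise treats those inside [T]. *)
Lemma dynamic_recoloring (k : nat) (T : {set G}) (d : G -> 'I_k) :
    (forall v, neigh v :&: T != set0) ->
    {in T &, forall s t, adj s t -> d s != d t} ->
    (forall v, neigh v \subset T -> (2 <= deg v)%N ->
      exists s t, [/\ s \in neigh v, t \in neigh v & d s != d t]) ->
  (dynamic_chromatic_number G <= chromatic_number G + k)%N.
Proof.
move=> hit dT two; rewrite /dynamic_chromatic_number; case: ex_minnP => n _; apply.
rewrite /chromatic_number; case: ex_minnP => m /existsP[c /forallP cP] _.
pose f := [ffun v => if v \in T then rshift m (d v) else lshift k (c v)].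
have fP s t : (if s \in T then if t \in T then d s != d t else true
   else if t \in T then true else c s != c t) -> f s != f t.
  rewrite !ffunE; case: (s \in T); case: (t \in T);
  by rewrite ?eq_rshift ?eq_rlshift ?eq_lrshift ?eq_lshift.
apply/existsP; exists f; apply/andP; split.
  apply/forallP=> u; apply/forallP=> v; apply/implyP => uv; apply: fP.
  case: ifP => uT; case: ifP => vT //; first exact: dT.
  by have /forallP/(_ v)/implyP := cP u; apply.
apply/forallP => v.
have two_colors s t : s \in neigh v -> t \in neigh v -> f s != f t ->
    (minn 2 (deg v) <= #|f @: neigh v|)%N.
  move=> sv tv st; apply: leq_trans (geq_minl _ _) _.
  apply: leq_trans (_ : #|[set f s; f t]| <= _)%N; first by rewrite cards2 st.
  by apply: subset_leq_card; apply/subsetP => x /set2P[] ->; apply: imset_f.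
have [w /setIP[wv wT]] := set0Pn _ (hit v).
have [vT|/subsetPn[u uv uT]] := boolP (neigh v \subset T); last first.
  by apply: (two_colors w u) => //; apply: fP; rewrite wT (negPf uT).
have [deg2|deg1] := boolP (1 < deg v)%N; last first.
  move: deg1; rewrite -leqNgt => /(leq_trans (geq_minr _ _))/leq_trans; apply.
  by rewrite card_gt0; apply/set0Pn; exists (f w); apply: imset_f.
have [s [t [sv tv st]]] := two v vT deg2.
by apply: (two_colors s t) => //; apply: fP; rewrite !(subsetP vT).
Qed.

(** [T] induces a graph of maximum degree at most [n], which is coloured greedily. *)
Lemma sparse_hitting_bound (n : nat) (T : {set G}) :
    (forall v, neigh v :&: T != set0) -> (forall v, ~~ (neigh v \subset T)) ->
    (forall v, #|neigh v :&: T| <= n)%N ->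
  (dynamic_chromatic_number G <= chromatic_number G + n.+1)%N.
Proof.
move=> hit notT sparse.
have [S ST /set0Pn[t tS]|d dT] :=
    @degenerate_coloring G (@adj G) n T (@adj_sym G) (@adj_irrefl G).
  exists t => //; apply: leq_trans (sparse t); apply: subset_leq_card.
  apply/subsetP => s; rewrite !inE => /andP[sS ->].
  exact: (subsetP ST).
by apply: (@dynamic_recoloring _ T d) => // v vT; case/negP: (notT v).
Qed.

(* Recolour a minimal hitting set [T]: each [t \in T] has a private neighbour
   [w t], with [N(w t) :&: T = {t}].  The coloring of [T] must separate the
   pair [a v, b v] for every [v] with [N(v) \subset T]; taking [a v = w v] when
   [v \in T] makes the constraint graph degenerate. *)
Lemma dynamic_max_degree_bound : (1 <= min_degree G)%N ->
  (dynamic_chromatic_number G <= chromatic_number G + (max_degree G).+1)%N.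
Proof.
move=> delta_gt0.
pose hits T := [forall v, neigh v :&: T != set0].
have hitsV : hits [set: G].
  apply/forallP => v; rewrite setIT -card_gt0.
  exact: leq_trans delta_gt0 (min_le_deg v).
have [T /minsetP[/forallP hitT minT] _] := minset_exists hitsV.
have [w wP] : exists w : G -> G, forall t, t \in T -> neigh (w t) :&: T = [set t].
  apply: (@fin_all_exists G (fun=> G) (fun t wt => t \in T -> neigh wt :&: T = [set t])) => t.
  case: (boolP (t \in T)) => [tT|]; last by exists t.
  (* By minimality, dropping [t] leaves some neighbourhood unhit; it meets [T] only in [t]. *)
  have : ~~ hits (T :\ t).
    apply/negP => /minT/(_ (subsetDl _ _)) eqT.
    by rewrite -eqT !inE eqxx in tT.
  rewrite negb_forall => /existsP[u]; rewrite negbK => /eqP uT; exists u => _.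
  apply/eqP; rewrite eqEsubset sub1set inE tT andbT.
  have sub : neigh u :&: T \subset [set t].
    apply/subsetP => x /setIP[xu xT]; apply: contraT; rewrite inE => xt.
    suff : x \in set0 by rewrite in_set0.
    by rewrite -uT in_setI xu in_setD1 xt xT.
  rewrite sub /=; have [x /setIP[xu xT]] := set0Pn _ (hitT u).
  by have /set1P <- : x \in [set t] by rewrite (subsetP sub) // inE xu.
pose B := [set v | (neigh v \subset T) && (1 < deg v)%N].
have [a [b abP]] : exists a, exists b, forall v, v \in B ->
    [/\ a v \in neigh v, b v \in neigh v, a v != b v & v \in T -> a v = w v].
  suff pairs v : exists ab, v \in B -> [/\ ab.1 \in neigh v, ab.2 \in neigh v,
      ab.1 != ab.2 & v \in T -> ab.1 = w v].
    have [ab abP] := fin_all_exists pairs.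
    by exists (fun v => (ab v).1), (fun v => (ab v).2).
  have [|vB] := boolP (v \in B); last by exists (v, v).
  rewrite inE => /andP[_ deg2].
  have [a av aw] : exists2 a, a \in neigh v & v \in T -> a = w v.
    have [vT|vT] := boolP (v \in T); last first.
      by have [x /setIP[xv _]] := set0Pn _ (hitT v); exists x.
    exists (w v) => //; have : v \in neigh (w v) :&: T by rewrite wP // set11.
    by case/setIP; rewrite !mem_neigh adj_sym.
  have : (0 < #|neigh v :\ a|)%N by move: deg2; rewrite /deg (cardsD1 a) av.
  by case/card_gt0P => b /setD1P[ba bv]; exists (a, b); rewrite eq_sym.
pose pair s t := [exists v in B, ((s == a v) && (t == b v)) || ((t == a v) && (s == b v))].
pose e s t := adj s t || pair s t.
have e_sym : symmetric e.
  move=> s t; rewrite /e adj_sym; congr orb.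
  by apply: eq_existsb => v; rewrite orbC.
have e_irr : irreflexive e.
  move=> s; rewrite /e adj_irrefl; apply/existsP => -[v /andP[vB]].
  have [_ _ ab _] := abP v vB; rewrite orbb => /andP[/eqP sa /eqP sb].
  by rewrite -sa -sb eqxx in ab.
pose other t v := if t == a v then b v else a v.
have pairP s t : pair t s -> exists v, [/\ v \in B, v \in neigh t, s = other t v &
     (s == a v) || (t == a v)].
  case/existsP => v /andP[vB ts]; exists v; have [av bv ab _] := abP v vB.
  rewrite /other; case/orP: ts => /andP[/eqP -> /eqP ->].
    by rewrite eqxx orbT; split=> //; move: av; rewrite !mem_neigh adj_sym.
  by rewrite eqxx eq_sym (negPf ab); split=> //; move: bv; rewrite !mem_neigh adj_sym.
have degE (S : {set G}) : S \subset T -> S != set0 ->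
    exists2 t, t \in S & (#|[set s in S | e t s]| <= max_degree G)%N.
  move=> ST S0; pose W := w @: (B :&: T).
  (* If [t = w u] with [u] in [B :&: T], then [u] is the only neighbour of [t] in [T]. Moreover
     [w t] is not in [B], since a neighbourhood inside [T] would be just [t]. This leaves at most
     [1 + (deg t - 1)] constraints. *)
  have [/set0Pn[t /setIP[tS /imsetP[u /setIP[uB uT] tu]]]|] := boolP (S :&: W != set0).
    have tT := subsetP ST t tS.
    exists t => //; apply: leq_trans (deg_le_max t).
    have wt_t : w t \in neigh t.
      have : t \in neigh (w t) :&: T by rewrite wP // set11.
      by case/setIP; rewrite !mem_neigh adj_sym.
    rewrite /deg [leqRHS](cardsD1 (w t)) wt_t.
    apply: leq_trans (_ : #|u |: other t @: (neigh t :\ w t)| <= _)%N; last first.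
      by rewrite cardsU1 leq_add ?leq_b1 ?leq_imset_card.
    apply: subset_leq_card; apply/subsetP => s; rewrite inE => /andP[sS].
    case/orP => [ts|/pairP[v [vB vt -> _]]].
      have : s \in neigh (w u) :&: T by rewrite inE -tu mem_neigh ts (subsetP ST).
      by rewrite wP // !inE => /eqP->; rewrite eqxx.
    rewrite setU1r // imset_f // in_setD1 vt andbT; apply: contraTneq vB => ->.
    rewrite inE; apply/andP => -[wT]; rewrite /deg.
    by rewrite -(setIidPl wT) wP // cards1.
  (* Now any [t] works: a pair from [v \in T] would put [a v = w v] into [S :&: W]. So pairs come
     from neighbours of [t] outside [T], adjacencies from those inside. *)
  rewrite negbK => /eqP SW; have [t tS] := set0Pn _ S0.
  exists t => //; apply: leq_trans (deg_le_max t).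
  rewrite /deg -[leqRHS](cardsID T).
  apply: leq_trans (_ : #|(neigh t :&: T) :|: other t @: (neigh t :\: T)| <= _)%N; last first.
    by apply: leq_trans (leq_card_setU _ _) _; rewrite leq_add2l leq_imset_card.
  apply: subset_leq_card; apply/subsetP => s; rewrite inE => /andP[sS].
  rewrite in_setU.
  case/orP => [ts|/pairP[v [vB vt st sta]]].
    by rewrite in_setI mem_neigh ts (subsetP ST).
  apply/orP; right; rewrite st imset_f // in_setD vt andbT; apply/negP => vT.
  have [_ _ _ /(_ vT) avw] := abP v vB.
  have : a v \in S :&: W.
    rewrite in_setI {2}avw imset_f ?in_setI ?vB //= andbT.
    by case/orP: sta => /eqP <-.
  by rewrite SW in_set0.
have [d dP] := degenerate_coloring e_sym e_irr degE.
apply: (@dynamic_recoloring _ T d) => //.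
  by move=> s t sT tT st; apply: dP => //; rewrite /e st.
move=> v vT deg2; have vB : v \in B by rewrite inE vT.
have [av bv _ _] := abP v vB; exists (a v), (b v); split=> //.
apply: dP; rewrite ?(subsetP vT) //; apply/orP; right.
by apply/exists_inP; exists v; rewrite ?eqxx.
Qed.

End Graph.

(** * Sparse hitting sets *)

Lemma card_bigcup_leq (I T : finType) (A : {set I}) (F : I -> {set T}) (m : nat) :
  (forall i, i \in A -> #|F i| <= m)%N -> (#|\bigcup_(i in A) F i| <= #|A| * m)%N.
Proof.
move=> Fm; rewrite -sum_nat_const.
apply: leq_trans (_ : \sum_(i in A) #|F i| <= _)%N; last exact: leq_sum.
elim/big_rec2: _ => [|i n B _ IH]; first by rewrite cards0.
by apply: leq_trans (leq_card_setU _ _) _; rewrite leq_add2l.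
Qed.

Lemma min_le_max_degree (G : sgraph) : (min_degree G <= max_degree G)%N.
Proof.
have [v _|G0] := pickP G; first exact: leq_trans (min_le_deg v) (deg_le_max v).
by rewrite /min_degree /max_degree !big_pred0 // eq_card0.
Qed.

(** Both [W] and [v] lie in the union of the neighbourhoods of neighbours of [v]; counting [v] makes
    the inequality strict. *)
Lemma card_neigh_meet (G : sgraph) (v : G) : (0 < deg v)%N ->
  (#|[set w | (w != v) && ~~ [disjoint neigh v & neigh w]]| < max_degree G ^ 2)%N.
Proof.
case/card_gt0P => u0 u0v; set W := [set _ | _].
have vW : v \notin W by rewrite inE eqxx.
have -> : #|W|.+1 = #|v |: W| by rewrite cardsU1 vW.
apply: leq_trans (_ : #|\bigcup_(u in neigh v) neigh u| <= _)%N.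
  apply: subset_leq_card; apply/subsetP => w /setU1P[->|].
    by apply/bigcupP; exists u0 => //; move: u0v; rewrite !mem_neigh adj_sym.
  rewrite inE => /andP[_ /pred0Pn[u /andP[/= uv uw]]].
  by apply/bigcupP; exists u => //; move: uw; rewrite !mem_neigh adj_sym.
apply: leq_trans (card_bigcup_leq (m := max_degree G) _) _.
  by move=> u _; apply: deg_le_max.
by rewrite leq_mul2r deg_le_max orbT.
Qed.

(** * Exponential estimates and a Chernoff bound *)

Section Estimates.
Variable R : realType.

Lemma exprn_le_expR (a b : R) (n : nat) :
  0 <= a -> a <= expR b -> a ^+ n <= expR (b * n%:R).
Proof. by move=> a0 ab; rewrite expRM_natr lerXn2r ?nnegrE ?expR_ge0. Qed.

Lemma expR1_ge2 : 2 <= expR 1 :> R.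
Proof. by have := expR_ge1Dx (1 : R); rewrite -[2]/(1 + 1). Qed.

(** For [n > 0] this inverts [(1 + 1/n)^n <= e]. It gives [x (1 - x)^(M - 1) >= 1/(eM)] at
    [x = 1/M]. *)
Lemma inv_expR1_le (n : nat) : 
  (expR 1)^-1 <= (1 - n.+1%:R^-1) ^+ n :> R.
Proof.
case: n => [|n]; first by rewrite expr0 invf_le1 ?expR_gt0 // ltW // expR_gt1.
have -> : 1 - n.+2%:R^-1 = (1 + n.+1%:R^-1)^-1 :> R.
  have := ltr0Sn R n; rewrite -[n.+2]addn1 natrD => n0; field.
  by rewrite !gt_eqF //; lra.
rewrite exprVn lef_pV2 ?posrE ?expR_gt0 ?exprn_gt0 ?addr_gt0 ?invr_gt0 ?ltr0Sn //.
rewrite [X in _ <= expR X](_ : 1 = n.+1%:R^-1 * n.+1%:R); last first.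
  by rewrite mulVf // pnatr_eq0.
apply: exprn_le_expR; first by rewrite addr_ge0 // invr_ge0.
exact: expR_ge1Dx.
Qed.

(** The mean of [e^|A :&: S|] is [(1 + p(e - 1))^|A| <= exp(p(e - 1)D)]; dividing by [exp(epD)]
    leaves [exp(-pD)]. *)
Lemma prob_card_ge_expR (V : finType) (A : {set V}) (p D : R) :
  0 <= p -> p <= 1 -> #|A|%:R <= D ->
  prob p (fun S => expR 1 * (p * D) <= #|A :&: S|%:R) <= expR (- (p * D)).
Proof.
move=> p0 p1 AD; have e1 : 1 <= expR 1 :> R by rewrite ltW // expR_gt1.
rewrite -(@ler_pM2l _ (expR (expR 1 * (p * D)))) ?expR_gt0 // -expRD.
apply: le_trans (prob_card_ge p0 p1 A (expR_ge0 1) _) _.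
  by move=> k aD; rewrite -expRM_natr mul1r ler_expR.
apply: le_trans (exprn_le_expR (b := p * (expR 1 - 1)) _ _ _) _.
- by rewrite addr_ge0 ?mulr_ge0 ?expR_ge0 ?subr_ge0.
- by apply: le_trans (expR_ge1Dx _); lra.
rewrite ler_expR (_ : _ - p * D = p * (expR 1 - 1) * D); last by ring.
by rewrite ler_wpM2l // mulr_ge0 // subr_ge0.
Qed.

End Estimates.

(** * A sparse hitting set from the local lemma *)

Section SparseHitting.
Variables (R : realType) (G : sgraph).
Let D : R := (max_degree G)%:R.
Let delta : R := (min_degree G)%:R.
Let L : R := ln (2 * expR 1 * (D ^+ 2 + 1)).
Hypothesis delta_ge1 : (1 <= min_degree G)%N.

Lemma expR_L : expR L = 2 * expR 1 * (D ^+ 2 + 1).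
Proof.
by rewrite lnK // posrE !mulr_gt0 ?expR_gt0 ?ltr_wpDl ?exprn_ge0.
Qed.

Lemma L_ge1 : 1 <= L.
Proof.
rewrite -ler_expR expR_L; have := expR1_ge2 R; have : 0 <= D ^+ 2 by rewrite exprn_ge0.
nra.
Qed.

Lemma exists_sparse_hitting : expR 1 * L <= delta ->
  exists T : {set G}, forall v, [/\ neigh v :&: T != set0,
    ~~ (neigh v \subset T) & #|neigh v :&: T|%:R < expR 1 * (D / delta) * L].
Proof.
move=> eL; have e2 := expR1_ge2 R; have L1 := L_ge1.
(* This gives [M >= 4] below, so that [x = 1/M] is less than 1. *)
have d2 : 2 <= delta by nra.
have dD : delta <= D by rewrite ler_nat min_le_max_degree.
have [d0 D0] : 0 < delta /\ 0 < D by split; lra.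
pose p := L / delta.
have p0 : 0 <= p by rewrite divr_ge0; lra.
have pe : p <= expR (- 1).
  by rewrite expRN ler_pdivrMr // ler_pdivlMl ?expR_gt0.
have p1 : p <= 1 by apply: le_trans pe _; rewrite expRN invf_le1 ?expR_gt0 //; lra.
pose E v (S : {set G}) := [disjoint neigh v & S] ||
  ((neigh v \subset S) || (expR 1 * (p * D) <= #|neigh v :&: S|%:R)).
pose M := (max_degree G ^ 2)%N.
have M4 : (4 <= M)%N.
  have : (2 <= max_degree G)%N by rewrite -(ler_nat R); apply: le_trans dD.
  by rewrite -(leq_sqr 2).
have MD : M%:R = D ^+ 2 by rewrite natrX.
have M4R : 4 <= M%:R :> R by rewrite (ler_nat R 4).
have degD (v : G) : (deg v)%:R <= D by rewrite ler_nat; apply: deg_le_max.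
have degd (v : G) : (min_degree G <= deg v)%N := min_le_deg v.
have pd : p * delta = L by rewrite /p divfK // gt_eqF.
have q0 := expR_gt0 (- L).
have prob_hit (v : G) : prob p (fun S => [disjoint neigh v & S]) <= expR (- L).
  rewrite prob_disjoint; apply: le_trans (_ : (1 - p) ^+ min_degree G <= _).
    by rewrite ler_wiXn2l ?subr_ge0 ?gerBl // degd.
  have -> : - L = - p * delta by rewrite mulNr pd.
  apply: exprn_le_expR.
    by rewrite subr_ge0.
  exact: expR_ge1Dx.
(* Uses [p <= 1/e] and [delta >= e L >= 2 L]. *)
have prob_sub (v : G) : prob p (fun S => neigh v \subset S) <= expR (- L) ^+ 2.
  rewrite prob_subset; apply: le_trans (_ : p ^+ min_degree G <= _).
    by rewrite ler_wiXn2l // degd.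
  apply: le_trans (exprn_le_expR _ p0 pe) _.
  by rewrite -expRM_natr ler_expR -/delta; nra.
have prob_sparse (v : G) :
    prob p (fun S => expR 1 * (p * D) <= #|neigh v :&: S|%:R) <= expR (- L).
  apply: le_trans (prob_card_ge_expR p0 p1 (degD v)) _.
  by rewrite ler_expR lerN2 -pd; apply: ler_wpM2l.
have probE (v : G) : prob p (E v) <= M%:R^-1 * (1 - M%:R^-1) ^+ M.-1.
  apply: le_trans (prob_or p0 p1 _ _) _.
  apply: le_trans (lerD (prob_hit v) (prob_or p0 p1 _ _)) _.
  apply: le_trans (lerD (lexx _) (lerD (prob_sub v) (prob_sparse v))) _.
  apply: le_trans (_ : M%:R^-1 * (expR 1)^-1 <= _); last first.
    rewrite ler_wpM2l ?invr_ge0 ?ler0n //.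
    by have := inv_expR1_le R M.-1; rewrite prednK //; apply: leq_trans M4.
  (* The claim becomes [1/(e(M + 1)) + 1/(4e^2(M + 1)^2) <= 1/(eM)]. *)
  rewrite expRN expR_L -MD.
  have [en0 Mn0 M1n0] : [/\ expR 1 != 0 :> R, M%:R != 0 :> R & M%:R + 1 != 0 :> R].
    by rewrite !gt_eqF //; lra.
  rewrite -subr_ge0 (_ : _ - _ = (4 * expR 1 * (M%:R + 1) - M%:R) /
      (4 * expR 1 ^+ 2 * M%:R * (M%:R + 1) ^+ 2)); last first.
    by field; rewrite en0 Mn0 M1n0.
  apply: divr_ge0; first by nra.
  by rewrite !mulr_ge0 ?exprn_ge0 //; lra.
have [v||||v|T notE] := @local_lemma R G p p0 p1 G E (fun v => neigh v) M%:R^-1 M.-1.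
- move=> S T ST; congr (_ || (_ || _)).
  + by rewrite -!setI_eq0 ![neigh v :&: _]setIC ST.
  + by rewrite !(sameP setIidPl eqP) ![neigh v :&: _]setIC ST.
  + by rewrite ![neigh v :&: _]setIC ST.
- by rewrite invr_ge0.
- by rewrite invf_lt1; lra.
- exact: probE.
- rewrite -ltnS prednK; last exact: leq_trans M4.
  by apply: card_neigh_meet; apply: leq_trans delta_ge1 (degd v).
exists T => v; have := notE v; rewrite /E !negb_or -setI_eq0 => /and3P[-> ->].
rewrite -ltNge => lt; split=> //; apply: lt_le_trans lt _.
by rewrite le_eqVlt; apply/orP; left; apply/eqP; rewrite /p; ring.
Qed.
End SparseHitting.

(** * The bound, by cases on the minimum degree *)

Theorem theorem3 (R : realType) (G : sgraph)
    (hdelta : (1 <= min_degree G)%N) :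
  (dynamic_chromatic_number G)%:Z - (chromatic_number G)%:Z <=
    Num.ceil (expR 1 * ((max_degree G)%:R / (min_degree G)%:R)
              * ln (2 * expR 1 * ((max_degree G)%:R ^+ 2 + 1)) : R).
Proof.
set D : R := (max_degree G)%:R; set delta : R := (min_degree G)%:R.
set L := ln _; set X := _ * L.
have d0 : 0 < delta by rewrite ltr0n.
(* Strictness absorbs the extra colour: [n < X] gives [n + 1 <= ceil X]. *)
suff [n nX chi] : exists2 n, n%:R < X &
    (dynamic_chromatic_number G <= chromatic_number G + n.+1)%N.
  have : n%:Z < Num.ceil X by rewrite ceil_gt_int.
  by move: (Num.ceil X) => k; lia.
(* For small [delta], the factor [e L / delta] exceeds 1, so [X > D]. *)
have [small|large] := ltP delta (expR 1 * L).
  exists (max_degree G); last exact: dynamic_max_degree_bound.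
  rewrite (_ : X = D * (expR 1 * L) / delta); last by rewrite /X; ring.
  rewrite ltr_pdivlMr // ltr_pM2l // ltr0n.
  exact: leq_trans hdelta (min_le_max_degree G).
have [T TP] := exists_sparse_hitting hdelta large.
pose n := (\max_(v : G) #|neigh v :&: T|)%N.
have [v _|G0] := pickP G; last first.
  by move: hdelta; rewrite /min_degree big_pred0 // eq_card0.
(* The maximum is attained at a vertex, so it inherits the strict bound. *)
have [|w nw] := @bigop.eq_bigmax G (fun u => #|neigh u :&: T|).
  by apply/card_gt0P; exists v.
exists n; first by rewrite /n nw; case: (TP w).
apply: (@sparse_hitting_bound _ n T) => u; try by case: (TP u).
exact: (leq_bigmax u).
Qed.
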